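(* Let $I$ be a non-empty set of unary connective symbols disjoint from $\{\vee,\to,\cdot,0,1\}$. The deductive system $S_{\mathcal{H}}$ is (Blok–Pigozzi) algebraizable with equivalent algebraic semantics the variety $\mathcal{R}(I)$ of I-modal ririgs and structural transformers $\tau(\varphi)=\{\varphi\approx 1\}$ and $\rho(\varphi\approx\psi)=\{\varphi\to\psi,\ \psi\to\varphi\}$. That is, for all sets of formulas $\Gamma\cup\{\varphi\}$ and all sets of equations $\Theta\cup\{\alpha\approx\beta\}$: (1) $\Gamma\vdash_{S_{\mathcal{H}}}\varphi$ iff $\tau[\Gamma]\vDash_{\mathcal{R}(I)}\tau(\varphi)$; (2) $\Theta\vDash_{\mathcal{R}(I)}\alpha\approx\beta$ iff $\rho[\Theta]\vdash_{S_{\mathcal{H}}}\rho(\alpha\approx\beta)$; (3) $\varphi\dashv\vdash_{S_{\mathcal{H}}}\rho[\tau(\varphi)]$; (4) $\{\alpha\approx\beta\}$ and $\tau[\rho(\alpha\approx\beta)]$ are mutual $\vDash_{\mathcal{R}(I)}$-consequences.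
   Context: A ririg is an algebra $(A,\vee,\cdot,\to,0,1)$ such that $(A,\vee,0)$ and $(A,\cdot,1)$ are commutative monoids, $x\cdot 0=0$, $x\cdot(y\vee z)=(x\cdot y)\vee(x\cdot z)$ and $1\vee x=1$ for all $x,y,z$ (order: $x\leq y$ iff $x\vee y=y$), and $a\cdot b\leq c$ iff $a\leq b\to c$. A modal operator on a ririg is a unary operation $m$ with $m(1)=1$ and $m(x\to y)\leq m(x)\to m(y)$. An I-modal ririg is a ririg with a modal operator $m$ for each $m\in I$; $\mathcal{R}(I)$ is the variety of all of them. $\mathbf{Fm}$ is the absolutely free algebra of formulas over a countably infinite set of variables in the language $\{\vee,\to,\cdot,0,1\}\cup I$. Write $\bot$ for the constant $0$, and $\top:=\bot\to\bot$; the constant $1$ is identified with $\top$. A statement $\varphi\leftrightarrow\psi$ abbreviates the two formulas $\varphi\to\psi$ and $\psi\to\varphi$. The Hilbert calculus $\mathcal{H}$ has the axiom schemes: (1) $\varphi\to\varphi$; (2) $(\varphi\to\psi)\to[(\psi\to\chi)\to(\varphi\to\chi)]$; (3) $\varphi\cdot\psi\to\varphi$; (4) $\varphi\cdot\psi\to\psi\cdot\varphi$; (5) $[(\varphi\cdot\psi)\to\chi]\to[\psi\to(\varphi\to\chi)]$; (6) $[\psi\to(\varphi\to\chi)]\to[(\varphi\cdot\psi)\to\chi]$; (7) $\varphi\to(\varphi\vee\psi)$; (8) $\psi\to(\varphi\vee\psi)$; (9) $\varphi\cdot(\psi\vee\chi)\to[(\varphi\cdot\psi)\vee(\varphi\cdot\chi)]$;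 (10) $\bot\to\varphi$; and, for every $m\in I$, ($m$11) $m(\top)\leftrightarrow\top$; ($m$12) $m(\varphi\to\psi)\to(m(\varphi)\to m(\psi))$. Its rules are: from $\varphi\to\psi$ and $\varphi$ infer $\psi$; from $\varphi$ infer $m(\varphi)$ (for every $m\in I$); from $\varphi\to\chi$ and $\psi\to\chi$ infer $(\varphi\vee\psi)\to\chi$. $\Gamma\vdash_{S_{\mathcal{H}}}\varphi$ means that there is a finite $\mathcal{H}$-deduction of $\varphi$ from finitely many formulas of $\Gamma$ (rules applicable to any previously derived formulas); $S_{\mathcal{H}}=\langle\mathbf{Fm},\vdash_{S_{\mathcal{H}}}\rangle$. For a class $\mathcal{K}$ of algebras, $\Theta\vDash_{\mathcal{K}}\alpha\approx\beta$ means: for every $\mathbf{A}\in\mathcal{K}$ and every homomorphism $v:\mathbf{Fm}\to\mathbf{A}$, if $v(\epsilon)=v(\delta)$ for all $\epsilon\approx\delta\in\Theta$, then $v(\alpha)=v(\beta)$. A set on the right of $\vdash$ or $\vDash$ means that each of its members follows; $\tau[\Gamma]=\bigcup_{\gamma\in\Gamma}\tau(\gamma)$ and similarly for $\rho$. A transformer is structural if it commutes with substitutions (endomorphisms of $\mathbf{Fm}$). *)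

(* Defs.v *)
From Stdlib Require List.
From mathcomp Require Import all_boot.
From mathcomp Require Import boolp classical_sets.

Set Implicit Arguments.
Unset Strict Implicit.
Unset Printing Implicit Defensive.

Local Open Scope classical_set_scope.

Record algebra (I : Type) := Algebra {
  carrier :> Type;
  join : carrier -> carrier -> carrier;
  mul : carrier -> carrier -> carrier;
  imp : carrier -> carrier -> carrier;
  zero : carrier;
  one : carrier;
  modal : I -> carrier -> carrier }.

Arguments zero {I} a.
Arguments one {I} a.

Record is_hom (I : Type) (A B : algebra I) (h : A -> B) : Prop := IsHom {
  hom_join : forall x y, h (join x y) = join (h x) (h y);
  hom_mul : forall x y, h (mul x y) = mul (h x) (h y);
  hom_imp : forall x y, h (imp x y) = imp (h x) (h y);
  hom_zero : h (zero A) = zero B;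
  hom_one : h (one A) = one B;
  hom_modal : forall m x, h (modal m x) = modal m (h x) }.

Definition prod_algebra (I J : Type) (A : J -> algebra I) : algebra I :=
  {| carrier := forall j, A j;
     join x y := fun j => join (x j) (y j);
     mul x y := fun j => mul (x j) (y j);
     imp x y := fun j => imp (x j) (y j);
     zero := fun j => zero (A j);
     one := fun j => one (A j);
     modal m x := fun j => modal m (x j) |}.

(* Closure under subalgebras is stated for isomorphic copies of them. *)
Record variety (I : Type) := Variety {
  variety_class :> set (algebra I);
  variety_H : forall (A B : algebra I) (h : A -> B),
    is_hom h -> (forall y, exists x, h x = y) ->
    variety_class A -> variety_class B;
  variety_S : forall (A B : algebra I) (h : A -> B),
    is_hom h -> injective h -> variety_class B -> variety_class A;
  variety_P : forall (J : Type) (A : J -> algebra I),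
    (forall j, variety_class (A j)) -> variety_class (prod_algebra A) }.

Definition le (I : Type) (A : algebra I) (x y : A) : Prop := join x y = y.

Record is_ririg (I : Type) (A : algebra I) : Prop := IsRirig {
  joinA : forall x y z : A, join x (join y z) = join (join x y) z;
  joinC : forall x y : A, join x y = join y x;
  join0x : forall x : A, join (zero A) x = x;
  mulA : forall x y z : A, mul x (mul y z) = mul (mul x y) z;
  mulC : forall x y : A, mul x y = mul y x;
  mul1x : forall x : A, mul (one A) x = x;
  mulx0 : forall x : A, mul x (zero A) = zero A;
  mulDr : forall x y z : A, mul x (join y z) = join (mul x y) (mul x z);
  join1x : forall x : A, join (one A) x = one A;
  residuation : forall a b c : A, le (mul a b) c <-> le a (imp b c) }.

Definition modal_operator (I : Type) (A : algebra I) (m : A -> A) : Prop :=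
  m (one A) = one A /\ forall x y : A, le (m (imp x y)) (imp (m x) (m y)).

Definition is_modal_ririg (I : Type) (A : algebra I) : Prop :=
  is_ririg A /\ forall i : I, modal_operator (@modal I A i).

Section ModalRirigVariety.
Variable I : Type.

Lemma le_trans_ririg (A : algebra I) (x y z : A) :
  is_ririg A -> le x y -> le y z -> le x z.
Proof. by move=> rA xy yz; rewrite /le -yz (joinA rA) xy. Qed.

Lemma joinxx_ririg (A : algebra I) (x : A) : is_ririg A -> join x x = x.
Proof.
move=> rA; rewrite -{1 2}(mul1x rA x) (mulC rA) -(mulDr rA) (join1x rA).
by rewrite (mulC rA) (mul1x rA).
Qed.

Lemma le_joinl_ririg (A : algebra I) (x y : A) :
  is_ririg A -> le x (join x y).
Proof. by move=> rA; rewrite /le (joinA rA) joinxx_ririg. Qed.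

Lemma modal_ririg_H (A B : algebra I) (h : A -> B) :
  is_hom h -> (forall y, exists x, h x = y) ->
  is_modal_ririg A -> is_modal_ririg B.
Proof.
move=> [hj hm hi h0 h1 hM] hs [rA mA].
split; last first.
  move=> i; have [m1 mI] := mA i; split; first by rewrite -h1 -hM m1.
  move=> x y; have [a <-] := hs x; have [b <-] := hs y.
  by rewrite /le -hi -!hM -hi -hj mI.
split.
- move=> x y z; have [a <-] := hs x; have [b <-] := hs y; have [c <-] := hs z.
  by rewrite -!hj (joinA rA).
- move=> x y; have [a <-] := hs x; have [b <-] := hs y.
  by rewrite -!hj (joinC rA).
- by move=> x; have [a <-] := hs x; rewrite -h0 -hj (join0x rA).
- move=> x y z; have [a <-] := hs x; have [b <-] := hs y; have [c <-] := hs z.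
  by rewrite -!hm (mulA rA).
- move=> x y; have [a <-] := hs x; have [b <-] := hs y.
  by rewrite -!hm (mulC rA).
- by move=> x; have [a <-] := hs x; rewrite -h1 -hm (mul1x rA).
- by move=> x; have [a <-] := hs x; rewrite -h0 -hm (mulx0 rA).
- move=> x y z; have [a <-] := hs x; have [b <-] := hs y; have [c <-] := hs z.
  by rewrite -!(hj, hm) (mulDr rA).
- by move=> x; have [a <-] := hs x; rewrite -h1 -hj (join1x rA).
move=> x y z; have [a <-] := hs x; have [b <-] := hs y; have [c <-] := hs z.
rewrite /le -hm -hi -!hj; split=> [abc | abc].
  have : le a (imp b (join (mul a b) c)).
    by apply/(residuation rA)/le_joinl_ririg.
  by rewrite /le => /(congr1 h); rewrite hj hi abc -hi -hj.
have bc : le (mul (imp b c) b) c.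
  by apply/(residuation rA); rewrite /le joinxx_ririg.
have {}abc : h (mul (join a (imp b c)) b) = h (mul (imp b c) b).
  by rewrite hm abc -hm.
rewrite -bc (joinA rA) hj.
by rewrite (mulC rA a) (mulC rA (imp b c)) -(mulDr rA) (mulC rA) abc
           (mulC rA b) -hj.
Qed.

Lemma modal_ririg_S (A B : algebra I) (h : A -> B) :
  is_hom h -> injective h -> is_modal_ririg B -> is_modal_ririg A.
Proof.
move=> [hj hm hi h0 h1 hM] hI [rB mB].
have hle x y : le x y <-> le (h x) (h y).
  by rewrite /le -hj; split=> [-> //|/hI].
split; last first.
  move=> i; have [m1 mI] := mB i; split; first by apply: hI; rewrite hM h1.
  by move=> x y; apply/hle; rewrite hi !hM hi.
split.
- by move=> x y z; apply: hI; rewrite !hj (joinA rB).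
- by move=> x y; apply: hI; rewrite !hj (joinC rB).
- by move=> x; apply: hI; rewrite hj h0 (join0x rB).
- by move=> x y z; apply: hI; rewrite !hm (mulA rB).
- by move=> x y; apply: hI; rewrite !hm (mulC rB).
- by move=> x; apply: hI; rewrite hm h1 (mul1x rB).
- by move=> x; apply: hI; rewrite hm h0 (mulx0 rB).
- by move=> x y z; apply: hI; rewrite !(hj, hm) (mulDr rB).
- by move=> x; apply: hI; rewrite hj h1 (join1x rB).
- move=> a b c; apply: (iff_trans (hle _ _)).
  apply: iff_trans (iff_sym (hle _ _)).
  by rewrite hm hi; apply: residuation.
Qed.

Lemma modal_ririg_P (J : Type) (A : J -> algebra I) :
  (forall j, is_modal_ririg (A j)) -> is_modal_ririg (prod_algebra A).
Proof.
move=> AP; have rA j : is_ririg (A j) by case: (AP j).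
have ext (x y : prod_algebra A) : (forall j, x j = y j) -> x = y.
  exact: functional_extensionality_dep.
have leP (x y : prod_algebra A) : le x y <-> forall j, le (x j) (y j).
  split=> [xy j|xy]; last by apply: ext => j; apply: xy.
  exact: (congr1 (fun f : prod_algebra A => f j) xy).
split; last first.
  move=> i; split; first by apply: ext => j; case: (AP j) => _ /(_ i)[].
  by move=> x y; apply/leP => j; case: (AP j) => _ /(_ i)[_]; apply.
split.
- by move=> x y z; apply: ext => j; apply: joinA.
- by move=> x y; apply: ext => j; apply: joinC.
- by move=> x; apply: ext => j; apply: join0x.
- by move=> x y z; apply: ext => j; apply: mulA.
- by move=> x y; apply: ext => j; apply: mulC.
- by move=> x; apply: ext => j; apply: mul1x.
- by move=> x; apply: ext => j; apply: mulx0.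
- by move=> x y z; apply: ext => j; apply: mulDr.
- by move=> x; apply: ext => j; apply: join1x.
- move=> a b c; split=> /leP abc; apply/leP => j.
    exact/(residuation (rA j))/abc.
  exact/(residuation (rA j))/abc.
Qed.

Definition modal_ririgs : variety I :=
  {| variety_class := [set A | is_modal_ririg A];
     variety_H := modal_ririg_H;
     variety_S := modal_ririg_S;
     variety_P := modal_ririg_P |}.

End ModalRirigVariety.

Arguments modal_ririgs : clear implicits.

(* The constant 1 is not a constructor: it is identified with
   \top := \bot -> \bot (see [Top] and [FmAlg]). *)
Inductive Fm (I : Type) : Type :=
| Var of nat
| Bot
| Or of Fm I & Fm I
| Mul of Fm I & Fm I
| Imp of Fm I & Fm I
| Mod of I & Fm I.

Arguments Var {I} n.
Arguments Bot {I}.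

Declare Scope fm_scope.
Delimit Scope fm_scope with fm.
Bind Scope fm_scope with Fm.
Notation "p :* q" := (Mul p q) (at level 40) : fm_scope.
Notation "p :| q" := (Or p q) (at level 50, left associativity) : fm_scope.
Notation "p :=> q" := (Imp p q) (at level 55, right associativity) : fm_scope.

Local Open Scope fm_scope.

Definition Top (I : Type) : Fm I := Bot :=> Bot.
Arguments Top {I}.

Definition FmAlg (I : Type) : algebra I :=
  {| carrier := Fm I;
     join := @Or I; mul := @Mul I; imp := @Imp I;
     zero := Bot; one := Top; modal := @Mod I |}.

Definition substitution (I : Type) (s : Fm I -> Fm I) : Prop :=
  @is_hom I (FmAlg I) (FmAlg I) s.

Definition equation (I : Type) : Type := (Fm I * Fm I)%type.
Notation "p :~ q" := ((p, q) : equation _) (at level 70) : fm_scope.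

Definition subst_eq (I : Type) (s : Fm I -> Fm I) (e : equation I) :
  equation I := s e.1 :~ s e.2.

Definition entails_all (X : Type) (R : set X -> X -> Prop) (G H : set X) :
  Prop := forall x, H x -> R G x.

Definition set_of_seq (X : Type) (s : seq X) : set X := [set x | List.In x s].

Record deductive_system (I : Type) := DeductiveSystem {
  entails :> set (Fm I) -> Fm I -> Prop;
  ds_refl : forall (G : set (Fm I)) p, G p -> entails G p;
  ds_mono : forall (G H : set (Fm I)) p, G `<=` H -> entails G p -> entails H p;
  ds_cut : forall (G H : set (Fm I)) p,
    entails_all entails G H -> entails H p -> entails G p;
  ds_structural : forall (s : Fm I -> Fm I) (G : set (Fm I)) p,
    substitution s -> entails G p -> entails (s @` G) (s p);
  ds_finitary : forall (G : set (Fm I)) p, entails G p ->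
    exists D : seq (Fm I), set_of_seq D `<=` G /\ entails (set_of_seq D) p }.

Definition eq_entails (I : Type) (K : set (algebra I))
    (Th : set (equation I)) (e : equation I) : Prop :=
  forall (A : algebra I), K A ->
  forall v : FmAlg I -> A, is_hom v ->
    (forall d, Th d -> v d.1 = v d.2) -> v e.1 = v e.2.

Inductive axiomH (I : Type) : Fm I -> Prop :=
| ax1 p : axiomH (p :=> p)
| ax2 p q r : axiomH ((p :=> q) :=> ((q :=> r) :=> (p :=> r)))
| ax3 p q : axiomH (p :* q :=> p)
| ax4 p q : axiomH (p :* q :=> q :* p)
| ax5 p q r : axiomH ((p :* q :=> r) :=> (q :=> (p :=> r)))
| ax6 p q r : axiomH ((q :=> (p :=> r)) :=> (p :* q :=> r))
| ax7 p q : axiomH (p :=> p :| q)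
| ax8 p q : axiomH (q :=> p :| q)
| ax9 p q r : axiomH (p :* (q :| r) :=> (p :* q) :| (p :* r))
| ax10 p : axiomH (Bot :=> p)
| ax11l m : axiomH (Mod m Top :=> Top)
| ax11r m : axiomH (Top :=> Mod m Top)
| ax12 m p q : axiomH (Mod m (p :=> q) :=> (Mod m p :=> Mod m q)).

Inductive ruleH (I : Type) : seq (Fm I) -> Fm I -> Prop :=
| rule_mp p q : ruleH [:: p :=> q; p] q
| rule_nec m p : ruleH [:: p] (Mod m p)
| rule_or p q r : ruleH [:: p :=> r; q :=> r] ((p :| q) :=> r).

Definition justified (I : Type) (G : set (Fm I)) (d : seq (Fm I)) (p : Fm I) :
  Prop :=
  [\/ axiomH p, G p
    | exists2 ps, ruleH ps p & set_of_seq ps `<=` set_of_seq d].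

(* A deduction is listed with its most recent formula first. *)
Inductive deduction (I : Type) (G : set (Fm I)) : seq (Fm I) -> Prop :=
| deduction_nil : deduction G [::]
| deduction_cons p d :
    deduction G d -> justified G d p -> deduction G (p :: d).

Definition provesH (I : Type) (G : set (Fm I)) (p : Fm I) : Prop :=
  exists D d : seq (Fm I),
    set_of_seq D `<=` G /\ deduction (set_of_seq D) (p :: d).

Section HilbertSystem.
Variable I : Type.
Implicit Types (G H : set (Fm I)) (p : Fm I) (d D : seq (Fm I)).

Lemma justified_sub G H d d' p : G `<=` H ->
  set_of_seq d `<=` set_of_seq d' -> justified G d p -> justified H d' p.
Proof.
move=> GH dd' [ax|/GH Hp|[ps rps psd]]; [exact: Or31|exact: Or32|].
by apply: Or33; exists ps => // q /psd/dd'.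
Qed.

Lemma deduction_sub G H d : G `<=` H -> deduction G d -> deduction H d.
Proof.
move=> GH; elim=> [|p {}d _ IH jp]; constructor => //.
exact: justified_sub jp.
Qed.

Lemma deduction_justified G d p : deduction G d -> List.In p d ->
  justified G d p.
Proof.
elim=> //= q {}d _ IH jq [<-|/IH jp].
  by apply: justified_sub jq => // r; right.
by apply: justified_sub jp => // r; right.
Qed.

Lemma deduction_cat G H D d : deduction G D ->
  (forall p, H p -> justified G D p) -> deduction H d -> deduction G (d ++ D).
Proof.
move=> dD HD; elim=> //= p {}d _ IH jp; constructor => //.
have inD : set_of_seq D `<=` set_of_seq (d ++ D).
  by move=> q qD; apply/List.in_or_app; right.
case: jp => [ax|/HD jp|[ps rps psd]]; [exact: Or31| |].
  exact: justified_sub jp.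
apply: Or33; exists ps => // q /psd qd.
by apply/List.in_or_app; left.
Qed.

Lemma provesH_refl G p : G p -> provesH G p.
Proof.
move=> Gp; exists [:: p], [::]; split=> [q [<-|[]] //|].
by constructor; [constructor|apply: Or32; left].
Qed.

Lemma provesH_mono G H p : G `<=` H -> provesH G p -> provesH H p.
Proof. by move=> GH [D [d [DG dd]]]; exists D, d; split=> // q /DG/GH. Qed.

Lemma provesH_cut G H p :
  entails_all (@provesH I) G H -> provesH H p -> provesH G p.
Proof.
move=> GH [D [d [DH dd]]].
have [D' [d' [D'G dd' Dd']]] : exists D' d', [/\ set_of_seq D' `<=` G,
    deduction (set_of_seq D') d' & forall q, List.In q D -> List.In q d'].
  elim: D DH {dd} => [|q D IH] DH.
    by exists [::], [::]; split=> //; constructor.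
  have [|D1 [d1 [D1G dd1 Dd1]]] := IH; first by move=> r rD; apply: DH; right.
  have [|D2 [d2 [D2G dd2]]] := GH q; first by apply: DH; left.
  exists (D1 ++ D2), ((q :: d2) ++ d1); split.
  - by move=> r rD; have [/D1G|/D2G] := List.in_app_or _ _ _ rD.
  - have dd1' : deduction (set_of_seq (D1 ++ D2)) d1.
      by apply: deduction_sub dd1 => r rD; apply/List.in_or_app; left.
    have dd2' : deduction (set_of_seq (D1 ++ D2)) (q :: d2).
      by apply: deduction_sub dd2 => r rD; apply/List.in_or_app; right.
    by apply: (deduction_cat dd1' _ dd2') => r; apply: Or32.
  - by move=> r [<-|/Dd1 rd1]; [left|right; apply/List.in_or_app; right].
exists D', (d ++ d'); split=> //.
apply: (deduction_cat dd' _ dd) => q /Dd'; exact: deduction_justified.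
Qed.

Lemma provesH_structural (s : Fm I -> Fm I) G p :
  substitution s -> provesH G p -> provesH (s @` G) (s p).
Proof.
move=> [sj sm si s0 s1 sM] [D [d [DG dd]]].
have {}sj q r : s (q :| r) = s q :| s r by exact: sj.
have {}sm q r : s (q :* r) = s q :* s r by exact: sm.
have {}si q r : s (q :=> r) = s q :=> s r by exact: si.
have {}s0 : s Bot = Bot by [].
have {}s1 : s Top = Top by [].
have {}sM m q : s (Mod m q) = Mod m (s q) by exact: sM.
exists (map s D), (map s d); split.
  by move=> q /List.in_map_iff[r [<- /DG Gr]]; exists r.
rewrite -[s p :: _]/(map s (p :: d)).
elim: {d}(p :: d) / dd => [|q d _ IH jq] /=; constructor => //.
case: jq => [ax|Dq|[ps rps psd]].
- by apply: Or31; case: ax => *; rewrite ?(si, sj, sm, sM, s0, s1); constructor.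
- by apply: Or32; apply: List.in_map.
- apply: Or33; exists (map s ps).
    by case: rps => *; rewrite /= ?(si, sj, sM); constructor.
  by move=> _ /List.in_map_iff[r [<- /psd rd]]; apply: List.in_map.
Qed.

Lemma provesH_finitary G p : provesH G p ->
  exists D, set_of_seq D `<=` G /\ provesH (set_of_seq D) p.
Proof. by move=> [D [d [DG dd]]]; exists D; split=> //; exists D, d; split. Qed.

Definition S_H : deductive_system I :=
  {| entails := @provesH I;
     ds_refl := provesH_refl;
     ds_mono := provesH_mono;
     ds_cut := provesH_cut;
     ds_structural := provesH_structural;
     ds_finitary := provesH_finitary |}.

End HilbertSystem.

Arguments S_H : clear implicits.

Definition structural_fm (I : Type) (tau : Fm I -> set (equation I)) : Prop :=
  forall s, substitution s -> forall p, tau (s p) = subst_eq s @` tau p.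

Definition structural_eq (I : Type) (rho : equation I -> set (Fm I)) : Prop :=
  forall s, substitution s -> forall e, rho (subst_eq s e) = s @` rho e.

Record algebraizable (I : Type) (S : deductive_system I) (K : variety I)
    (tau : Fm I -> set (equation I)) (rho : equation I -> set (Fm I)) : Prop :=
  Algebraizable {
  alg_tau_structural : structural_fm tau;
  alg_rho_structural : structural_eq rho;
  alg_tau : forall (G : set (Fm I)) (p : Fm I),
    S G p <-> entails_all (eq_entails K) (\bigcup_(g in G) tau g) (tau p);
  alg_rho : forall (Th : set (equation I)) (e : equation I),
    eq_entails K Th e <-> entails_all S (\bigcup_(d in Th) rho d) (rho e);
  alg_rho_tau : forall p : Fm I,
    entails_all S [set p] (\bigcup_(e in tau p) rho e) /\
    entails_all S (\bigcup_(e in tau p) rho e) [set p];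
  alg_tau_rho : forall e : equation I,
    entails_all (eq_entails K) [set e] (\bigcup_(p in rho e) tau p) /\
    entails_all (eq_entails K) (\bigcup_(p in rho e) tau p) [set e] }.

Definition tauH (I : Type) (p : Fm I) : set (equation I) := [set p :~ Top].

Definition rhoH (I : Type) (e : equation I) : set (Fm I) :=
  [set e.1 :=> e.2; e.2 :=> e.1].

(* Main.v *)
Require Import Defs.
From mathcomp Require Import all_boot.
From mathcomp Require Import boolp classical_sets.

(** Both directions of algebraizability rest on one observation: in a ririg the
unit is the top element, so residuation gives [x -> y = 1] iff [x <= y]. Hence
an equation [x = y] is the same as the two implications taking the value 1.

Soundness ([provesH_sound]) is an induction on deductions: under this reading
each axiom scheme is an inequality valid in modal ririgs, and each rule is a
fact about the order.

Completeness is the Lindenbaum-Tarski construction. For a fixed theory [G], the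
relation [G |- p :=> q] is a preorder on formulas. The currying schemes [ax5]
and [ax6] say that product and implication form a residuated pair for it, which
yields monotonicity and associativity of the product; weakening [ax3] makes
[Top] the largest formula and the unit; the rule for disjunction makes [p :| q]
a least upper bound; necessitation and the distribution scheme [ax12] make
every modality monotone. So mutual
provable implication is a congruence, the quotient [lindenbaum G] is a modal
ririg ([lindenbaum_modal_ririg]), and the projection [cls G] is a valuation
that identifies [p] and [q] exactly when [G] proves both implications
([cls_eqP]). In particular it sends exactly the theorems of [G] to 1
([cls_eq_one]), so a semantic consequence, evaluated at this valuation, is a
provable one. *)

(* Puts the operations of algebras back in front of their homonyms. *)
Import Defs.

Set Implicit Arguments.
Unset Strict Implicit.
Unset Printing Implicit Defensive.

Local Open Scope classical_set_scope.
Local Open Scope fm_scope.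

(** * Order in a ririg and soundness *)

Section RirigOrder.
Variables (I : Type) (A : algebra I).
Hypothesis rA : is_ririg A.
Implicit Types x y z : A.

Lemma le_refl x : le x x.
Proof. exact: joinxx_ririg. Qed.

Lemma le_antisym x y : le x y -> le y x -> x = y.
Proof. by rewrite /le => xy yx; rewrite -yx (joinC rA). Qed.

Lemma le_one x : le x (one A).
Proof. by rewrite /le (joinC rA) (join1x rA). Qed.

(** The bridge between truth values and order: residuation at
[1 * x = x] gives [1 <= x -> y] iff [x <= y], and the unit is the top element. *)
Lemma imp_eq_one x y : imp x y = one A <-> le x y.
Proof.
rewrite -[X in le X y](mul1x rA) (residuation rA).
by split=> [->|]; [exact: le_refl | rewrite /le (join1x rA) => <-].
Qed.

Lemma le_mul x y x' y' : le x x' -> le y y' -> le (mul x y) (mul x' y').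
Proof.
have mono (a b c : A) : le b c -> le (mul a b) (mul a c).
  by move=> bc; rewrite /le -(mulDr rA) bc.
move=> xx' yy'; apply: (le_trans_ririg rA (mono x _ _ yy')).
by rewrite !(mulC rA _ y'); apply: mono.
Qed.

Lemma mul_lel x y : le (mul x y) x.
Proof.
have := le_mul (le_refl x) (le_one y).
by rewrite (mulC rA x (one A)) (mul1x rA).
Qed.

Lemma mul_imp_le x y : le (mul x (imp x y)) y.
Proof. by rewrite (mulC rA); apply/(residuation rA); apply: le_refl. Qed.

End RirigOrder.

Section Soundness.
Variables (I : Type) (A : algebra I) (v : FmAlg I -> A).
Hypotheses (mrA : is_modal_ririg A) (hv : is_hom v).

Let rA : is_ririg A := proj1 mrA.

Let vE := ((hom_join hv : forall p q, v (p :| q) = _),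
  (hom_mul hv : forall p q, v (p :* q) = _),
  (hom_imp hv : forall p q, v (p :=> q) = _),
  (hom_modal hv : forall m p, v (Mod m p) = _)).

Let v1 : v Top = one A := hom_one hv.

Lemma valuation_imp p q : v (p :=> q) = one A <-> le (v p) (v q).
Proof. by rewrite vE; apply: imp_eq_one. Qed.

Lemma axiomH_sound p : axiomH p -> v p = one A.
Proof.
have rf := le_refl rA.
have cur (x y z : A) : le (mul x y) z -> le x (imp y z).
  by move/(residuation rA).
have unc (x y z : A) : le x (imp y z) -> le (mul x y) z.
  by move/(residuation rA).
case=> {p} [p|p q r|p q|p q|p q r|p q r|p q|p q|p q r|p|m|m|m p q];
  apply/valuation_imp; rewrite ?(v1, vE).
- exact: rf.
- apply/cur/cur; rewrite (mulC rA) (mulA rA).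
  apply: (le_trans_ririg rA _ (mul_imp_le rA (v q) _)).
  exact: le_mul (mul_imp_le rA _ _) (rf _).
- exact: mul_lel.
- by rewrite (mulC rA); apply: rf.
- apply/cur/cur; rewrite -(mulA rA) (mulC rA) (mulC rA (v q)).
  exact: mul_imp_le.
- by apply/cur; rewrite (mulC rA (v p)) (mulA rA); apply/unc/unc/rf.
- exact: le_joinl_ririg.
- by rewrite (joinC rA); apply: le_joinl_ririg.
- by rewrite (mulDr rA); apply: rf.
- by rewrite (hom_zero hv : v Bot = _); apply: join0x.
- exact: le_one.
- by have [-> _] := proj2 mrA m; apply: rf.
- by have [_] := proj2 mrA m; apply.
Qed.

Lemma ruleH_sound ps p : ruleH ps p ->
  (forall q, List.In q ps -> v q = one A) -> v p = one A.
Proof.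
case=> {ps p} [p q|m p|p q r] true_ps.
- have pq : le (v p) (v q) by apply/valuation_imp/true_ps; left.
  have p1 : v p = one A by apply: true_ps; right; left.
  by move: pq; rewrite p1 /le (join1x rA).
- by rewrite vE true_ps; [case: (proj2 mrA m) | left].
- have pr : le (v p) (v r) by apply/valuation_imp/true_ps; left.
  have qr : le (v q) (v r) by apply/valuation_imp/true_ps; right; left.
  by apply/valuation_imp; rewrite vE /le -(joinA rA) qr.
Qed.

Lemma provesH_sound (G : set (Fm I)) p :
  (forall g, G g -> v g = one A) -> provesH G p -> v p = one A.
Proof.
move=> trueG [D [d [DG dd]]].
suff true_d : forall q, List.In q (p :: d) -> v q = one A.
  by apply: true_d; left.
elim: {p d}(p :: d) / dd => //= p d _ IH jp q [<-|/IH //].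
case: jp => [/axiomH_sound //|/DG/trueG //|[ps rps psd]].
by apply: (ruleH_sound rps) => r /psd/IH.
Qed.

End Soundness.

(** * The preorder of provable implication *)

Section ProvableImplication.
Variables (I : Type) (G : set (Fm I)).
Implicit Types p q r s : Fm I.

Local Notation "|- p" := (provesH G p) (at level 70).

Lemma provesH_axiom p : axiomH p -> |- p.
Proof.
move=> ax; exists [::], [::]; split=> [q []|].
by constructor; [constructor | apply: Or31].
Qed.

(** By cut, a rule need only be applied once, to its bare premises. *)
Lemma provesH_rule ps p :
  ruleH ps p -> (forall q, List.In q ps -> |- q) -> |- p.
Proof.
move=> rps prv_ps; apply: (provesH_cut (H := set_of_seq ps)) => //.
exists ps, ps; split=> //; constructor; last by apply: Or33; exists ps.
suff: forall d, set_of_seq d `<=` set_of_seq ps -> deduction (set_of_seq ps) d.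
  exact.
elim=> [|q d IH] sub; constructor.
  by apply: IH => r rd; apply: sub; right.
by apply/Or32/sub; left.
Qed.

Lemma provesH_mp p q : |- p :=> q -> |- p -> |- q.
Proof.
by move=> pq prv_p; apply: (provesH_rule (rule_mp p q)) => r [<-|[<-|[]]].
Qed.

Lemma provesH_nec m p : |- p -> |- Mod m p.
Proof. by move=> prv_p; apply: (provesH_rule (rule_nec m p)) => r [<-|[]]. Qed.

Lemma pimp_refl p : |- p :=> p.
Proof. exact/provesH_axiom/ax1. Qed.

Lemma pimp_trans q p r : |- p :=> q -> |- q :=> r -> |- p :=> r.
Proof.
by move=> pq; apply: provesH_mp; apply: provesH_mp pq; apply/provesH_axiom/ax2.
Qed.

Lemma pimp_mulC p q : |- p :* q :=> q :* p.
Proof. exact/provesH_axiom/ax4. Qed.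

(** Schemes [ax5] and [ax6] curry on the right factor; commutativity moves this to
the side on which ririgs are residuated. *)
Lemma pimp_residuation p q r : |- p :* q :=> r <-> |- p :=> q :=> r.
Proof.
split=> h.
  by apply: provesH_mp (pimp_trans (pimp_mulC q p) h); apply/provesH_axiom/ax5.
apply: pimp_trans (pimp_mulC p q) _.
by apply: provesH_mp h; apply/provesH_axiom/ax6.
Qed.

Lemma pimp_mull p q : |- p :* q :=> p.
Proof. exact/provesH_axiom/ax3. Qed.

Lemma pimp_const p q : |- p -> |- q :=> p.
Proof. by apply: provesH_mp; apply/pimp_residuation/pimp_mull. Qed.

Lemma provesH_Top : |- Top.
Proof. exact: pimp_refl. Qed.

Lemma pimp_mul_monol p q r : |- p :=> q -> |- p :* r :=> q :* r.
Proof.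
move=> pq; apply/pimp_residuation/(pimp_trans pq).
exact/pimp_residuation/pimp_refl.
Qed.

Lemma pimp_mul p q p' q' :
  |- p :=> p' -> |- q :=> q' -> |- p :* q :=> p' :* q'.
Proof.
move=> pp' qq'; apply: pimp_trans (pimp_mul_monol q pp') _.
apply: pimp_trans (pimp_mulC _ _) _; apply: pimp_trans (pimp_mulC q' p').
exact: pimp_mul_monol.
Qed.

Lemma pimp_eval p q : |- (p :=> q) :* p :=> q.
Proof. exact/pimp_residuation/pimp_refl. Qed.

Lemma pimp_imp p q p' q' :
  |- p' :=> p -> |- q :=> q' -> |- (p :=> q) :=> (p' :=> q').
Proof.
move=> p'p qq'; apply/pimp_residuation; apply: pimp_trans qq'.
by apply: pimp_trans (pimp_eval p q); apply: pimp_mul => //; apply: pimp_refl.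
Qed.

(** Exchange of premises: the commutativity of the product transported through
currying. *)
Lemma pimp_exchange p q r : |- (p :=> q :=> r) :=> (q :=> p :=> r).
Proof.
apply: (@pimp_trans (q :* p :=> r)); first exact/provesH_axiom/ax6.
apply: (@pimp_trans (p :* q :=> r)); last exact/provesH_axiom/ax5.
by apply: pimp_imp; [apply: pimp_mulC | apply: pimp_refl].
Qed.

(** No scheme states associativity. Curried, both products are iterated
implications out of the same premises, in orders differing by exchange. *)
Lemma pimp_mulA p q r : |- p :* (q :* r) :=> (p :* q) :* r.
Proof.
set s := (p :* q) :* r.
have qprs : |- q :=> p :=> r :=> s.
  apply/pimp_residuation/(pimp_trans (pimp_mulC q p)).
  by rewrite -pimp_residuation; apply: pimp_refl.
apply: pimp_trans (pimp_mulC _ _) _; apply/pimp_residuation/pimp_residuation.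
exact: pimp_trans qprs (pimp_exchange _ _ _).
Qed.

Lemma pimp_mulAr p q r : |- (p :* q) :* r :=> p :* (q :* r).
Proof.
apply: pimp_trans (pimp_mulC _ _) _.
apply: (@pimp_trans (r :* (q :* p))).
  by apply: pimp_mul; [apply: pimp_refl | apply: pimp_mulC].
apply: pimp_trans (pimp_mulA _ _ _) _.
apply: pimp_trans (pimp_mulC _ _) _.
by apply: pimp_mul; [apply: pimp_refl | apply: pimp_mulC].
Qed.

Lemma pimp_mulTop p : |- Top :* p :=> p.
Proof. exact: pimp_trans (pimp_mulC _ _) (pimp_mull _ _). Qed.

Lemma pimp_mulTopr p : |- p :=> Top :* p.
Proof.
apply: (@provesH_mp Top) provesH_Top.
exact/pimp_residuation/pimp_refl.
Qed.

Lemma pimp_orl p q : |- p :=> p :| q.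
Proof. exact/provesH_axiom/ax7. Qed.

Lemma pimp_orr p q : |- q :=> p :| q.
Proof. exact/provesH_axiom/ax8. Qed.

Lemma pimp_or_lub p q r : |- p :=> r -> |- q :=> r -> |- p :| q :=> r.
Proof.
by move=> pr qr; apply: (provesH_rule (rule_or p q r)) => s [<-|[<-|[]]].
Qed.

Lemma pimp_or p q p' q' :
  |- p :=> p' -> |- q :=> q' -> |- p :| q :=> p' :| q'.
Proof.
move=> pp' qq'; apply: pimp_or_lub.
  exact: pimp_trans pp' (pimp_orl _ _).
exact: pimp_trans qq' (pimp_orr _ _).
Qed.

Lemma pimp_mod m p q : |- p :=> q -> |- Mod m p :=> Mod m q.
Proof. by move=> /(provesH_nec m); apply/provesH_mp/provesH_axiom/ax12. Qed.

End ProvableImplication.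

(** * The Lindenbaum-Tarski algebra of a theory *)

Section Lindenbaum.
Variables (I : Type) (G : set (Fm I)).
Implicit Types p q r : Fm I.

Local Notation "|- p" := (provesH G p) (at level 70).

Definition pequiv p : Fm I -> Prop := fun q => |- p :=> q /\ |- q :=> p.

(** The modal ririg axioms are Leibniz equalities, so the quotient is formed
literally, as the type of equivalence classes. A class is a bare predicate,
not an element of [set (Fm I)]: a variety is itself a [set] of algebras, so the
universe of [set] lies strictly above that of carriers. *)
Definition lindenbaum_carrier : Type :=
  {C : Fm I -> Prop | exists p, C = pequiv p}.

Definition cls p : lindenbaum_carrier :=
  exist _ (pequiv p) (ex_intro _ p (erefl _)).

Definition cls_repr (x : lindenbaum_carrier) : Fm I :=
  projT1 (cid (proj2_sig x)).

Lemma cls_eqP p q : cls p = cls q <-> |- p :=> q /\ |- q :=> p.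
Proof.
split=> [/(congr1 (@proj1_sig _ _)) /= pqE|[pq qp]].
  suff: pequiv p q by [].
  by rewrite pqE; split; apply: pimp_refl.
apply/eq_exist/seteqP.
by split=> r [h1 h2]; split;
  [apply: pimp_trans h1 | apply: pimp_trans h2 _
  |apply: pimp_trans h1 | apply: pimp_trans h2 _].
Qed.

Lemma cls_reprK x : cls (cls_repr x) = x.
Proof.
by case: x => C hC; apply: eq_exist; rewrite /cls_repr; case: cid.
Qed.

Lemma cls_surj x : exists p, x = cls p.
Proof. by exists (cls_repr x); rewrite cls_reprK. Qed.

Lemma cls_reprP p : |- cls_repr (cls p) :=> p /\ |- p :=> cls_repr (cls p).
Proof. exact/cls_eqP/cls_reprK. Qed.

Definition lindenbaum : algebra I :=
  {| carrier := lindenbaum_carrier;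
     join x y := cls (cls_repr x :| cls_repr y);
     mul x y := cls (cls_repr x :* cls_repr y);
     imp x y := cls (cls_repr x :=> cls_repr y);
     zero := cls Bot;
     one := cls Top;
     modal m x := cls (Mod m (cls_repr x)) |}.

(** The operations act on chosen representatives; that the choice is immaterial
is the congruence property of provable equivalence, i.e. the monotonicity of
each connective in its arguments (antitonicity in a premise). *)
Lemma cls_hom : @is_hom I (FmAlg I) lindenbaum cls.
Proof.
split=> //= [p q|p q|p q|m p]; have [rp pr] := cls_reprP p;
  try (have [rq qr] := cls_reprP q); apply/cls_eqP; split.
- exact: pimp_or.
- exact: pimp_or.
- exact: pimp_mul.
- exact: pimp_mul.
- exact: pimp_imp.
- exact: pimp_imp.
- exact: pimp_mod.
- exact: pimp_mod.
Qed.

Lemma cls_eq_one p : cls p = one lindenbaum <-> |- p.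
Proof.
split=> [/cls_eqP[_ Tp]|prv_p]; first exact: provesH_mp Tp (provesH_Top G).
by apply/cls_eqP; split; apply: pimp_const => //; apply: provesH_Top.
Qed.

Lemma cls_le p q : @le I lindenbaum (cls p) (cls q) <-> |- p :=> q.
Proof.
rewrite /le -(hom_join cls_hom); split=> [/cls_eqP[pqq _]|pq].
  exact: pimp_trans (pimp_orl _ _ _) pqq.
apply/cls_eqP; split; last exact: pimp_orr.
by apply: pimp_or_lub => //; apply: pimp_refl.
Qed.

Lemma lindenbaum_modal_ririg : is_modal_ririg lindenbaum.
Proof.
have [hj hm hi h0 h1 hM] := cls_hom.
have refl := @pimp_refl I G.
split; last first.
  move=> m; split.
    rewrite -h1 -hM; apply/cls_eqP.
    by split; apply: provesH_axiom; [apply: ax11l | apply: ax11r].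
  move=> x y; have [p ->] := cls_surj x; have [q ->] := cls_surj y.
  by rewrite -hi -!hM -hi; apply/cls_le/provesH_axiom/ax12.
split.
- move=> x y z; have [p ->] := cls_surj x; have [q ->] := cls_surj y.
  have [r ->] := cls_surj z; rewrite -!hj; apply/cls_eqP; split.
    apply: pimp_or_lub.
      exact: pimp_trans (pimp_orl _ _ _) (pimp_orl _ _ _).
    by apply: pimp_or; [apply: pimp_orr | apply: refl].
  apply: pimp_or_lub; last exact: pimp_trans (pimp_orr _ _ _) (pimp_orr _ _ _).
  by apply: pimp_or; [apply: refl | apply: pimp_orl].
- move=> x y; have [p ->] := cls_surj x; have [q ->] := cls_surj y.
  rewrite -!hj; apply/cls_eqP.
  by split; apply: pimp_or_lub; [apply: pimp_orr | apply: pimp_orl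
                                |apply: pimp_orr | apply: pimp_orl].
- move=> x; have [p ->] := cls_surj x.
  by apply/cls_le/provesH_axiom/ax10.
- move=> x y z; have [p ->] := cls_surj x; have [q ->] := cls_surj y.
  have [r ->] := cls_surj z; rewrite -!hm; apply/cls_eqP.
  by split; [apply: pimp_mulA | apply: pimp_mulAr].
- move=> x y; have [p ->] := cls_surj x; have [q ->] := cls_surj y.
  by rewrite -!hm; apply/cls_eqP; split; apply: pimp_mulC.
- move=> x; have [p ->] := cls_surj x.
  rewrite -h1 -hm; apply/cls_eqP.
  by split; [apply: pimp_mulTop | apply: pimp_mulTopr].
- move=> x; have [p ->] := cls_surj x.
  rewrite -h0 -hm; apply/cls_eqP; split; last exact/provesH_axiom/ax10.
  exact: pimp_trans (pimp_mulC _ _ _) (pimp_mull _ _ _).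
- move=> x y z; have [p ->] := cls_surj x; have [q ->] := cls_surj y.
  have [r ->] := cls_surj z; rewrite -hj -!hm -hj; apply/cls_eqP.
  split; first exact/provesH_axiom/ax9.
  by apply: pimp_or_lub; apply: pimp_mul (refl p) _;
    [apply: pimp_orl | apply: pimp_orr].
- move=> x; have [p ->] := cls_surj x.
  rewrite -h1 -hj; apply/cls_eqP; split; last exact: pimp_orl.
  by apply: pimp_const; apply: provesH_Top.
- move=> x y z; have [p ->] := cls_surj x; have [q ->] := cls_surj y.
  have [r ->] := cls_surj z; rewrite -hm -hi.
  by rewrite !cls_le; apply: pimp_residuation.
Qed.

End Lindenbaum.

(** * Algebraizability *)

Theorem theorem6p5 (I : Type) (hI : inhabited I) :
  algebraizable (S_H I) (modal_ririgs I) (@tauH I) (@rhoH I).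
Proof.
split.
- move=> s sub p; have sT : s Top = Top := hom_one sub.
  by rewrite /tauH image_set1 /subst_eq /= sT.
- move=> s sub [p q].
  have sI a b : s (a :=> b) = s a :=> s b := hom_imp sub a b.
  by rewrite /rhoH image_setU !image_set1 /= !sI.
- move=> G p; split.
    move=> Gp _ -> A mrA v hv trueG /=.
    rewrite (hom_one hv : v Top = _).
    apply: (provesH_sound mrA hv _ Gp) => g Gg.
    by rewrite -(hom_one hv); apply: (trueG (g, Top)); exists g.
  move=> /(_ (p, Top) erefl) sem; apply/cls_eq_one.
  apply: (sem _ (lindenbaum_modal_ririg G) _ (cls_hom G)) => _ [g Gg ->] /=.
  exact/cls_eq_one/provesH_refl.
- move=> Th [p q]; split.
    move=> sem; set G := \bigcup_(d in Th) rhoH d.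
    have /cls_eqP[pq qp] : cls G p = cls G q.
      apply: (sem _ (lindenbaum_modal_ririg G) _ (cls_hom G)) => d Thd.
      apply/cls_eqP; split; apply: provesH_refl; exists d => //.
        by left.
      by right.
    by move=> _ [->|->].
  move=> prv A mrA v hv trueTh /=; have rA := proj1 mrA.
  have sound r : rhoH (p, q) r -> v r = one A.
    move=> /prv; apply: (provesH_sound mrA hv) => g [d /trueTh dE [->|->]];
    by apply/(valuation_imp mrA hv); rewrite dE; apply: le_refl.
  by apply: (le_antisym rA); apply/(valuation_imp mrA hv)/sound; [left|right].
- move=> p; split.
    move=> _ [_ -> [->|->]] /=; apply: pimp_const.
      exact: provesH_Top.
    exact: provesH_refl.
  move=> _ ->; apply: (@provesH_mp _ _ Top); last exact: provesH_Top.
  by apply: provesH_refl; exists (p, Top) => //; right.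
- move=> [p q]; split.
    move=> _ [_ [->|->] ->] A mrA v hv /(_ _ erefl) /= pq;
    rewrite (hom_one hv : v Top = _); apply/(valuation_imp mrA hv);
    by rewrite pq; apply: le_refl; case: mrA.
  move=> _ -> A mrA v hv trueR /=.
  have leR r s : rhoH (p, q) (r :=> s) -> le (v r) (v s).
    move=> rs; apply/(valuation_imp mrA hv); rewrite -(hom_one hv).
    by apply: (trueR (r :=> s, Top)); exists (r :=> s).
  by apply: (le_antisym (proj1 mrA)); apply: leR; [left|right].
Qed.
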